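(* Let $\mathcal{L}_n$ satisfy the $(\alpha,\tau)$-RSC condition, let $\rho_\lambda$ be $\mu$-amenable for some $\mu\in[0,\alpha_1)$, and let $\beta^*$ be $k$-sparse with support $S$. Consider the program $$\min_{\|\beta\|_1\le R,\ \beta\in\Omega}\{\mathcal{L}_n(\beta)+\rho_\lambda(\beta)\}. \qquad (P)$$ Suppose that $$2\max\Big\{\|\nabla\mathcal{L}_n(\beta^* )\|_\infty,\ \alpha_2\sqrt{\tfrac{\log k}{n}}\Big\}\le\lambda\le\sqrt{\frac{(2\alpha_1-\mu)\alpha_2}{56k}},$$ $$\max\Big\{2\|\beta^*\|_1,\ \frac{60k\lambda}{2\alpha_1-\mu}\Big\}\le R\le\min\Big\{\frac{\alpha_2}{8\lambda},\ \frac{\alpha_2}{\tau_2}\sqrt{\frac{n}{\log p}}\Big\},$$ that $n\ge\frac{2\tau_1}{2\alpha_1-\mu}k\log p$, and that for some $\delta\in\big[\frac{4R\tau_1\log p}{n\lambda},1\big]$ the dual vector $\hat z$ from the primal-dual witness (PDW) construction satisfies $\|\hat z_{S^c}\|_\infty\le1-\delta$. Then the unique stationary point $\hat\beta$ of $(P)$ has the following properties. (a) With $\widehat Q:=\int_0^1\nabla^2\mathcal{L}_n\big(\beta^*+t(\hat\beta-\beta^* )\big)\,dt$, $$\|\hat\beta-\beta^*\|_\infty\le\big\|(\widehat Q_{SS})^{-1}\nabla\mathcal{L}_n(\beta^* )_S\big\|_\infty+\lambda\,|||(\widehat Q_{SS})^{-1}|||_\infty.$$ (b) Moreover, if $\rho_\lambda$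 is $(\mu,\gamma)$-amenable and $\beta^*_{\min}:=\min_{j\in S}|\beta^*_j|$ satisfies $$\beta^*_{\min}\ge\lambda\big(\gamma+|||(\widehat Q_{SS})^{-1}|||_\infty\big)+\big\|(\widehat Q_{SS})^{-1}\nabla\mathcal{L}_n(\beta^* )_S\big\|_\infty,$$ then $\hat\beta$ equals the oracle estimator $\hat\beta^{\mathcal{O}}$, and $$\|\hat\beta-\beta^*\|_\infty\le\big\|(\widehat Q_{SS})^{-1}\nabla\mathcal{L}_n(\beta^* )_S\big\|_\infty.$$
   Context: Setting: $\Omega\subseteq\mathbb{R}^p$ is an open convex set; $\mathcal{L}_n:\mathbb{R}^p\to\mathbb{R}$ is an empirical loss based on $n$ samples, possibly nonconvex, twice continuously differentiable; $\lambda,R>0$. The penalty is coordinate-separable: $\rho_\lambda(\beta)=\sum_{j=1}^p\rho_\lambda(\beta_j)$ for a continuous univariate function $\rho_\lambda:\mathbb{R}\to\mathbb{R}$. The target $\beta^*=\arg\min_{\beta\in\Omega}\mathbb{E}[\mathcal{L}_n(\beta)]$ is assumed unique and independent of $n$; $S=\mathrm{supp}(\beta^* )$ and $k$-sparse means $|S|\le k$. $v_S$ and $M_{SS}$ denote restrictions of vectors and matrices to indices in $S$; $|||M|||_\infty$ is the $\ell_\infty$-operator norm (maximum absolute row sum). $\mu$-amenable ($\mu\ge 0$): (i) $\rho_\lambda(t)=\rho_\lambda(-t)$ for all $t$ and $\rho_\lambda(0)=0$; (ii) $\rho_\lambda$ is nondecreasing on $\mathbb{R}^+$; (iii) $t\mapsto\rho_\lambda(t)/t$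 is nonincreasing on $\mathbb{R}^+$ ($t>0$); (iv) $\rho_\lambda$ is differentiable at every $t\ne 0$; (v) $t\mapsto\rho_\lambda(t)+\frac{\mu}{2}t^2$ is convex; (vi) $\lim_{t\to0^+}\rho_\lambda'(t)=\lambda$. $(\mu,\gamma)$-amenable: in addition (vii) $\gamma\in(0,\infty)$ and $\rho_\lambda'(t)=0$ for all $t\ge\gamma\lambda$. Set $q_\lambda(t)=\lambda|t|-\rho_\lambda(t)$, which is everywhere differentiable, and $q_\lambda(\beta)=\sum_j q_\lambda(\beta_j)$. $(\alpha,\tau)$-RSC: with constants $\alpha_1,\alpha_2>0$ and $\tau_1,\tau_2\ge0$, for all $\beta,\Delta\in\mathbb{R}^p$, $$\langle\nabla\mathcal{L}_n(\beta+\Delta)-\nabla\mathcal{L}_n(\beta),\Delta\rangle\ge\begin{cases}\alpha_1\|\Delta\|_2^2-\tau_1\frac{\log p}{n}\|\Delta\|_1^2,&\|\Delta\|_2\le1,\\ \alpha_2\|\Delta\|_2-\tau_2\sqrt{\frac{\log p}{n}}\|\Delta\|_1,&\|\Delta\|_2\ge1.\end{cases}$$ Stationary point of $(P)$: a feasible $\tilde\beta$ such that $\langle\nabla\mathcal{L}_n(\tilde\beta)+\nabla\rho_\lambda(\tilde\beta),\beta-\tilde\beta\rangle\ge0$ for all feasible $\beta$, where $\langle\nabla\rho_\lambda(\tilde\beta),\beta-\tilde\beta\rangle:=\lim_{t\to0^+}\langle\nabla\rho_\lambda(\tilde\beta+t(\beta-\tilde\beta)),\beta-\tilde\beta\rangle$.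 PDW construction: let $\hat\beta_S\in\arg\min\{\mathcal{L}_n(\beta)+\rho_\lambda(\beta):\mathrm{supp}(\beta)\subseteq S,\ \|\beta\|_1\le R,\ \beta\in\Omega\}$ (vectors supported on $S$ are identified with elements of $\mathbb{R}^S$) and $\hat\beta=(\hat\beta_S,0_{S^c})$. Take $\hat z_S\in\partial\|\hat\beta_S\|_1$ and choose $\hat z_{S^c}$ so that $\hat z=(\hat z_S,\hat z_{S^c})$ satisfies $\nabla\mathcal{L}_n(\hat\beta)-\nabla q_\lambda(\hat\beta)+\lambda\hat z=0$. Under the stated assumptions the unique stationary point of $(P)$ is this $\hat\beta$. Oracle estimator: $\hat\beta^{\mathcal{O}}=(\hat\beta^{\mathcal{O}}_S,0_{S^c})$ with $\hat\beta^{\mathcal{O}}_S=\arg\min_{\beta_S\in\mathbb{R}^S}\mathcal{L}_n(\beta_S,0_{S^c})$.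
   Formalization: Uniqueness of the stationary point of (P) is not asserted, as it can fail under the stated bounds (e.g. p=k=2 with the MCP penalty); instead the PDW output is shown to be a stationary point satisfying (a) and (b), hence it is the unique one whenever a unique one exists. *)

(* Defs.v *)
(* MathComp / MathComp-Analysis.  Vectors of R^p are column vectors 'cV[R]_p.
   The library norm `|v| on matrices is the entrywise maximum, i.e. the
   l_infinity norm; the l_1 and l_2 norms are defined below. *)
From HB Require Import structures.
From mathcomp Require Import all_boot all_order all_algebra.
From mathcomp Require Import all_classical all_reals all_analysis.

Set Implicit Arguments.
Unset Strict Implicit.
Unset Printing Implicit Defensive.

Import Order.TTheory GRing.Theory Num.Theory.
Import numFieldNormedType.Exports.

Local Open Scope classical_set_scope.
Local Open Scope ring_scope.

Section Vectors.
Context {R : realType} {p : nat}.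
Implicit Types (u v b : 'cV[R]_p) (S : {set 'I_p}).

Definition dotp u v : R := \sum_(j < p) u j 0 * v j 0.

Definition l1norm v : R := \sum_(j < p) `|v j 0|.

Definition l2norm v : R := Num.sqrt (\sum_(j < p) v j 0 ^+ 2).

Definition supp v : {set 'I_p} := [set j | v j 0 != 0]%SET.

(* v_S and M_SS are indexed by 'I_#|S| through the enumeration of S *)
Definition subvec S v : 'cV[R]_#|S| :=
  rowsub (fun i => enum_val i) v.

Definition principal_submx S (M : 'M[R]_p) : 'M[R]_#|S| :=
  mxsub (fun i => enum_val i) (fun i => enum_val i) M.

(* min over S of |b_j|; the minimum of the empty family is +oo *)
Definition min_abs S b : \bar R :=
  \big[Order.min/+oo%E]_(j in S) (`|b j 0|)%:E.

Definition opnorm_inf m (M : 'M[R]_m) : R :=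
  \big[Num.max/0]_(i < m) \sum_(j < m) `|M i j|.

Definition subgradient (f : 'cV[R]_p -> R) (x z : 'cV[R]_p) : Prop :=
  forall y, f x + dotp z (y - x) <= f y.

End Vectors.

Definition argmin {T : Type} {d : Order.disp_t} {U : porderType d}
    (A : set T) (f : T -> U) : set T :=
  [set x | A x /\ forall y, A y -> (f x <= f y)%O].

Section Calculus.
Context {R : realType} {p : nat}.
Implicit Types (f : 'cV[R]_p -> R) (x y : 'cV[R]_p).

Definition grad f x : 'cV[R]_p := \col_j 'D_(delta_mx j 0) f x.

Definition hessian f x : 'M[R]_p :=
  \matrix_(i, j) 'D_(delta_mx j 0) (fun y => grad f y i 0) x.

Definition twice_cont_diff f : Prop :=
  [/\ forall x, differentiable f x,
      forall x, differentiable (grad f) x &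
      continuous (hessian f)].

(* entrywise integral of the Hessian along the segment from x to y *)
Definition avg_hessian f x y : 'M[R]_p :=
  \matrix_(i, j)
    Rintegral lebesgue_measure `[0, 1] (fun t => hessian f (x + t *: (y - x)) i j).

End Calculus.

Section Penalty.
Context {R : realType}.
Implicit Types (rho : R -> R) (lam mu gamma : R).

Definition amenable rho lam mu : Prop :=
  0 <= mu /\
  [/\ (forall t, rho t = rho (- t)) /\ rho 0 = 0,
      forall s t : R, 0 <= s -> s <= t -> rho s <= rho t,
      forall s t : R, 0 < s -> s <= t -> rho t / t <= rho s / s,
      forall t : R, t != 0 -> derivable rho t 1 &
      convex_function (setT : set R^o)
        (fun t : R => rho t + mu / 2 * t ^+ 2) /\
      (derive1 rho t @[t --> 0^'+] --> lam)].

Definition amenable_flat rho lam mu gamma : Prop :=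
  [/\ amenable rho lam mu, 0 < gamma &
      forall t, gamma * lam <= t -> derive1 rho t = 0].

Definition qfun rho lam (t : R) : R := lam * `|t| - rho t.

Definition sep_penalty p rho (b : 'cV[R]_p) : R := \sum_(j < p) rho (b j 0).

(* coordinatewise derivative; for the penalty itself the value at a zero
   coordinate is a default one *)
Definition sep_grad p (r : R -> R) (b : 'cV[R]_p) : 'cV[R]_p :=
  \col_j derive1 r (b j 0).

End Penalty.

Definition RSC {R : realType} (p n : nat) (f : 'cV[R]_p -> R)
    (alpha1 tau1 alpha2 tau2 : R) : Prop :=
  [/\ 0 < alpha1, 0 < alpha2, 0 <= tau1, 0 <= tau2 &
  forall b D : 'cV[R]_p,
    (l2norm D <= 1 ->
       alpha1 * l2norm D ^+ 2 - tau1 * (ln p%:R / n%:R) * l1norm D ^+ 2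
         <= dotp (grad f (b + D) - grad f b) D) /\
    (1 <= l2norm D ->
       alpha2 * l2norm D - tau2 * Num.sqrt (ln p%:R / n%:R) * l1norm D
         <= dotp (grad f (b + D) - grad f b) D)].

Section Program.
Context {R : realType} {p : nat}.
Variables (f : 'cV[R]_p -> R) (rho : R -> R) (Om : set 'cV[R]_p) (rad : R).

Definition feasible : set 'cV[R]_p := [set b | l1norm b <= rad /\ Om b].

(* A coordinate where b and b' both vanish contributes 0 to the inner product
   below, so the default value of the derivative of rho at 0 plays no role. *)
Definition stationary_point (b : 'cV[R]_p) : Prop :=
  feasible b /\
  forall b', feasible b' ->
    exists2 l : R,
      dotp (sep_grad rho (b + t *: (b' - b))) (b' - b) @[t --> 0^'+] --> l &
      0 <= dotp (grad f b) (b' - b) + l.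

Definition pdw (lam : R) (S : {set 'I_p}) (bhat zhat : 'cV[R]_p) : Prop :=
  [/\ argmin [set b | supp b \subset S /\ feasible b]
        (fun b => f b + sep_penalty rho b) bhat,
      subgradient (@l1norm R #|S|) (subvec S bhat) (subvec S zhat) &
      grad f bhat - sep_grad (qfun rho lam) bhat + lam *: zhat = 0].

End Program.

(* minimizers over R^S, identified with the vectors supported in S *)
Definition oracle {R : realType} p (f : 'cV[R]_p -> R) (S : {set 'I_p}) :
    set 'cV[R]_p :=
  argmin [set b | supp b \subset S] f.

(* Main.v *)
Require Import Defs.
From HB Require Import structures.
From mathcomp Require Import all_boot all_order all_algebra.
From mathcomp Require Import all_classical all_reals all_analysis.
From mathcomp Require Import ring lra.
Import Order.TTheory GRing.Theory Num.Theory.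
Import numFieldNormedType.Exports.
Local Open Scope classical_set_scope.
Local Open Scope ring_scope.

(** The proof rests on two facts about the loss and the penalty.

    Curvature.  For a vector [v] supported in [S], Cauchy-Schwarz bounds
    [l1norm v ^+ 2] by [#|S|] times [l2norm v ^+ 2].  The lower bound on the
    radius and the room left for [delta] below 1 make the sample size so large
    that the l_1 term of restricted strong convexity costs at most
    [alpha1 / 120].  Letting the increment shrink to 0, the Hessian at every
    point is positive definite on the vectors supported in [S]
    ([hessian_lower_bound], [RSC_hessian_lower_bound]).  This passes to the
    average Hessian, so [QSS] is invertible ([principal_submx_unit]).

    Slopes.  Amenability forces the slopes of the penalty away from 0 into
    [[-lam, lam]]: they are at most [rho t / t], which increases to [lam] as
    [t] decreases to 0 ([amenable_norm_derive1]).  They are also continuous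
    away from 0, since the derivative of a differentiable convex function is
    ([amenable_derive1_continuous]).

    The zero-subgradient equation of the primal-dual witness, read coordinate
    by coordinate, says that the gradient of the loss at [bhat] is minus a slope
    of the penalty where [bhat] does not vanish, and minus [lam] times a dual
    coordinate of modulus at most 1 where it does ([zero_subgradient_coord]).
    Stationarity follows at once, because moving a vanishing coordinate costs
    [lam] times the displacement ([zero_subgradient_stationary]).

    By the fundamental theorem of calculus along the segment,
    [bhat - bstar], restricted to [S], is [invmx QSS] applied to the difference
    of the two gradients restricted to [S] ([grad_sub_avg_hessian]).  The
    gradient at [bhat] has entries of modulus at most [lam], hence the first
    error bound.

    If the entries of [bstar] on [S] are large enough, that bound keeps every
    [bhat j] with [j] in [S] in the flat part of the penalty, so the gradient at
    [bhat] vanishes on [S].  The error bound then loses its second term, and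
    positive curvature makes [bhat] the only minimizer over the vectors
    supported in [S] ([restricted_strict_minimizer]). *)

(** * Derivatives of convex functions *)

(** The direction is a factor of the limit, so that the same statement serves
    for the two step lengths compared below and for reflections. *)
Lemma is_cvg_diff_quotient (R : realType) (g : R -> R) (x v : R) :
  derivable g x 1 ->
  h^-1 * (g (x + h * v) - g x) @[h --> 0^'] --> v * derive1 g x.
Proof.
move=> dg; have dfg : differentiable g x by apply/derivable1_diffP.
have -> : v * derive1 g x = 'D_v g x by rewrite deriveE// deriv1E.
have : derivable g x v by exact: diff_derivable.
move=> /cvg_ex[l Hl].
have -> : 'D_v g x = l by apply: cvg_lim.
apply: cvg_trans Hl; apply: near_eq_cvg; near=> h.
by rewrite /= /shift/= [x + _]addrC.
Unshelve. all: by end_near. Qed.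

(** Convexity between [x] and [y] bounds the difference quotients at [x] in the
    direction [y - x] by [g y - g x]; the slope is their limit. *)
Lemma convex_tangent (R : realType) (g : R -> R) (x y : R) :
  convex_function (setT : set R^o) g -> derivable g x 1 ->
  g x + (y - x) * derive1 g x <= g y.
Proof.
move=> cg /(@is_cvg_diff_quotient _ _ _ (y - x)) /cvg_dnbhs_at_right dg.
rewrite -lerBrDl -(cvg_lim _ dg)//; apply: limr_le;
  first by apply/cvg_ex; eexists; exact: dg.
near=> h.
have h0 : 0 < h by near: h; exact: nbhs_right_gt.
have h1 : h <= 1 by near: h; exact: nbhs_right_ltW.
rewrite ler_pdivrMl//.
have h01 : Itv.spec (@Itv.num_sem R) (Itv.Real `[0%Z, 1%Z]) h.
  by rewrite /= /Itv.num_sem/= num_real/= in_itv/= ltW.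
have := cg (Itv.mk h01) y x (mem_setT _) (mem_setT _).
rewrite !convRE/= => H.
have -> : x + h * (y - x) = h * y + (1 - h) * x by ring.
move: H; rewrite lerBlDr => /le_trans; apply; rewrite /unstable.onem; lra.
Unshelve. all: by end_near. Qed.

(** The tangent at [x + h], tested at [x] and at [x + 2h], traps the slope at
    [x + h] between the difference quotient [A] of step [h] and [B - A], where
    [B] is the increment over [2h] divided by [h].  As [h] tends to 0, [A] tends
    to the slope at [x] and [B] to twice that slope, so both bounds have the
    same limit. *)
Lemma convex_derive1_continuous (R : realType) (g : R -> R) (x : R) :
  convex_function (setT : set R^o) g ->
  (\forall y \near x, derivable g y 1) ->
  {for x, continuous (derive1 g)}.
Proof.
move=> cg dg; have dgx := nbhs_singleton dg.
apply/cvgrPdist_le => e e0; have e3 : 0 < e / 3 by rewrite divr_gt0.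
have := is_cvg_diff_quotient _ g x 1 dgx; rewrite mul1r.
move=> /cvgrPdist_le /(_ _ e3)[d1 /= d10 q1].
have := is_cvg_diff_quotient _ g x 2 dgx.
move=> /cvgrPdist_le /(_ _ e3)[d2 /= d20 q2].
near=> t; have [->|tx] := eqVneq t x; first by rewrite subrr normr0 ltW.
pose h := t - x; have tE : t = x + h by rewrite /h addrC subrK.
have h0 : h != 0 by rewrite subr_eq0.
have hd1 : ball 0 d1 h.
  by rewrite /ball/= sub0r normrN /h distrC; near: t; apply: cvgr_dist_lt.
have hd2 : ball 0 d2 h.
  by rewrite /ball/= sub0r normrN /h distrC; near: t; apply: cvgr_dist_lt.
have dgt : derivable g t 1 by near: t.
have := q1 h hd1 h0; have := q2 h hd2 h0.
rewrite mulr1 -tE; set B := h^-1 * _; set A := h^-1 * _.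
have hB : g (x + h * 2) - g x = h * B by rewrite /B mulVKf.
have hA : g t - g x = h * A by rewrite /A mulVKf.
have lo := convex_tangent _ g t x cg dgt.
have hi := convex_tangent _ g t (x + h * 2) cg dgt.
set d := derive1 g t in lo hi *; set D := derive1 g x.
have {}lo : h * A <= h * d by rewrite -hA; move: lo; rewrite tE; lra.
have {}hi : h * d <= h * (B - A).
  by rewrite mulrBr -hA -hB; move: hi; rewrite tE; lra.
rewrite !ler_norml => /andP[B1 B2] /andP[A1 A2]; apply/andP.
have [hpos|hneg|] := ltgtP h 0; last by move/eqP: h0.
- move: lo hi; rewrite !ler_nM2l// => lo hi; split; lra.
- move: lo hi; rewrite !ler_pM2l// => lo hi; split; lra.
Unshelve. all: by end_near. Qed.

(** * Slopes of an amenable penalty *)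

Section AmenablePenalty.
Context {R : realType} (rho : R -> R) (lam mu : R).
Hypothesis rhoA : amenable rho lam mu.

Lemma amenable_derive1_odd t : t != 0 -> derive1 rho (- t) = - derive1 rho t.
Proof.
have [_ [[even _] _ _ dr _]] := rhoA => t0.
have := is_cvg_diff_quotient _ rho t (-1) (dr t t0); rewrite mulN1r => H.
apply: cvg_lim => //; apply: cvg_trans H; apply: near_eq_cvg; near=> h.
by rewrite mulrN1 (even (t - h)) opprB (even t) [h - t]addrC.
Unshelve. all: by end_near. Qed.

Lemma amenable_derive1_ge0 t : 0 < t -> 0 <= derive1 rho t.
Proof.
have [_ [_ incr _ dr _]] := rhoA => t0.
have := is_cvg_diff_quotient _ rho t 1 (dr t (lt0r_neq0 t0)); rewrite mul1r.
move=> /cvg_dnbhs_at_right dq; rewrite -(cvg_lim _ dq)//.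
apply: limr_ge; first by apply/cvg_ex; eexists; exact: dq.
near=> h; have h0 : 0 < h by near: h; exact: nbhs_right_gt.
rewrite mulr_ge0 ?invr_ge0 ?(ltW h0)// mulr1 subr_ge0 incr// ?(ltW t0)//.
by rewrite lerDl ltW.
Unshelve. all: by end_near. Qed.

(** By the mean value theorem the quotient is a slope at some point strictly
    between 0 and [s], and these slopes tend to [lam]. *)
Lemma amenable_quotient_cvg : continuous rho ->
  rho s / s @[s --> 0^'+] --> lam.
Proof.
have [_ [[_ rho0] _ _ dr [_ dlam]]] := rhoA => crho.
apply/cvgrPdist_le => e e0.
move/cvgrPdist_le : dlam => /(_ e e0)[d /= d0 H].
near=> s.
have s0 : 0 < s by near: s; exact: nbhs_right_gt.
have sd : s < d by near: s; exact: nbhs_right_lt.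
have [//| |c] := @MVT R rho (derive1 rho) 0 s s0.
- move=> x /[!in_itv]/= /andP[x0 _]; rewrite derive1E.
  by apply: derivableP; exact/dr/lt0r_neq0.
- exact/continuous_subspaceT.
- rewrite in_itv/= => /andP[c0 cs]; rewrite rho0 !subr0 => ->.
  rewrite mulfK ?gt_eqF//; apply: H => //.
  by rewrite /ball_/= sub0r normrN gtr0_norm// (lt_trans cs).
Unshelve. all: by end_near. Qed.

Lemma amenable_le_lam t : continuous rho -> 0 < t -> rho t / t <= lam.
Proof.
move=> /amenable_quotient_cvg q t0; have [_ [_ _ decr _ _]] := rhoA.
rewrite -(cvg_lim _ q)//; apply: limr_ge;
  first by apply/cvg_ex; eexists; exact: q.
near=> s; apply: decr; first by near: s; exact: nbhs_right_gt.
by near: s; exact: nbhs_right_ltW.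
Unshelve. all: by end_near. Qed.

(** As [rho t / t] does not increase, the difference quotients at [t] are at
    most [rho t / t], which never exceeds its limit [lam] at 0. *)
Lemma amenable_derive1_le t : continuous rho -> 0 < t -> derive1 rho t <= lam.
Proof.
move=> crho t0; apply: le_trans (amenable_le_lam _ crho t0).
have [_ [_ _ decr dr _]] := rhoA.
have := is_cvg_diff_quotient _ rho t 1 (dr t (lt0r_neq0 t0)); rewrite mul1r.
move=> /cvg_dnbhs_at_right dq; rewrite -(cvg_lim _ dq)//.
apply: limr_le; first by apply/cvg_ex; eexists; exact: dq.
near=> h; have h0 : 0 < h by near: h; exact: nbhs_right_gt.
have th : t <= t + h by rewrite lerDl ltW.
have := decr t (t + h) t0 th.
rewrite ler_pdivrMr ?addr_gt0// mulr1 ler_pdivrMl// => H.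
apply: le_trans (lerB H (lexx _)) _.
by rewrite mulrDr divfK ?lt0r_neq0// addrAC subrr add0r mulrC.
Unshelve. all: by end_near. Qed.

Lemma amenable_norm_derive1 t : continuous rho -> t != 0 ->
  `|derive1 rho t| <= lam.
Proof.
move=> crho; wlog t0 : t / 0 < t => [wl t0|_].
  have [/wl//|tn0|t0'] := ltgtP 0 t; first exact.
    rewrite -normrN -amenable_derive1_odd//; apply: wl; lra.
  by rewrite t0' eqxx in t0.
by rewrite ger0_norm ?amenable_derive1_ge0// amenable_derive1_le.
Qed.

(** Adding [mu / 2 * t ^+ 2] makes [rho] convex, hence its derivative continuous
    away from 0, and changes the slope by a continuous term. *)
Lemma amenable_derive1_continuous t : t != 0 ->
  {for t, continuous (derive1 rho)}.
Proof.
have [_ [_ _ _ dr [cv _]]] := rhoA => t0.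
pose g := fun t => rho t + mu / 2 * t ^+ 2.
have nz : \forall y \near t, y != 0 :> R.
  have : (fun y : R => `|y|) @ t --> `|t| by apply: norm_continuous.
  move=> /cvgr_gt /(_ 0); rewrite normr_gt0 => /(_ t0).
  by apply: filterS => y; rewrite normr_gt0.
have dg y : y != 0 -> is_derive y (1 : R) g (derive1 rho y + mu * y).
  move=> /dr dy.
  have drho : is_derive y (1 : R) rho (derive1 rho y).
    by rewrite derive1E; exact: derivableP.
  have dsq : is_derive y (1 : R) ((id : R -> R) ^+ 2) (2 * y).
    have := @is_deriveX R R id 2 y 1 1 (is_derive_id y (1 : R)).
    by rewrite /GRing.scale/= mulr1 expr1.
  have := is_deriveD drho (@is_deriveZ R R R _ (mu / 2) _ _ _ dsq).
  by rewrite /GRing.scale/= mulrA divfK ?pnatr_eq0.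
have cg : {for t, continuous (derive1 g)}.
  apply: convex_derive1_continuous => //.
  by apply: filterS nz => y /dg dy; apply: ex_derive.
have : {for t, continuous (derive1 g \- *%R mu)}.
  by apply: continuousB => //; apply: mulrl_continuous.
have E y : y != 0 -> derive1 g y - mu * y = derive1 rho y.
  by move=> /dg dy; rewrite derive1E derive_val addrK.
rewrite /prop_for/continuous_at/= E// => H; apply: cvg_trans H;
  apply: near_eq_cvg.
by apply: filterS nz => y /E.
Qed.

(** At the kink [b = 0] the slope seen from either side tends to [lam] in
    absolute value and has the sign of the displacement, so its product with [v]
    tends to [lam * `|v|]. *)
Lemma amenable_right_limit b v :
  derive1 rho (b + t * v) * v @[t --> 0^'+] -->
    (if b == 0 then lam * `|v| else derive1 rho b * v).
Proof.
have [b0|b0] := eqVneq b 0; last first.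
  apply: cvgM; last exact: cvg_cst.
  apply: cvg_at_right_filter.
  have : {for 0 : R, continuous (derive1 rho \o (fun t : R => b + t * v))}.
    apply: continuous_comp.
      apply: continuousD; first exact: cst_continuous.
      exact: mulrr_continuous.
    by rewrite mul0r addr0; exact: amenable_derive1_continuous.
  by rewrite /prop_for/continuous_at/= mul0r addr0.
rewrite b0; under eq_cvg do rewrite add0r.
have [_ [_ _ _ _ [_ dlam]]] := rhoA.
have pos w : 0 < w -> derive1 rho (t * w) * w @[t --> 0^'+] --> lam * w.
  move=> w0; apply: cvgM; last exact: cvg_cst.
  apply/cvgrPdist_le => e e0; move/cvgrPdist_le : dlam => /(_ e e0)[d /= d0 H].
  near=> t; have t0 : 0 < t by near: t; exact: nbhs_right_gt.
  have td : t < d / w by near: t; apply: nbhs_right_lt; rewrite divr_gt0.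
  apply: H; last by rewrite mulr_gt0.
  by rewrite /ball_/= sub0r normrN gtr0_norm ?mulr_gt0// -ltr_pdivlMr.
have [v0|v0|v0] := ltgtP v 0; last 1 first.
- rewrite v0 normr0 mulr0.
  have -> : (fun t : R => derive1 rho (t * 0) * 0) = (fun=> 0).
    by apply/funext => t; rewrite mulr0.
  exact: cvg_cst.
- rewrite ltr0_norm//; have vn0 : 0 < - v by rewrite oppr_gt0.
  apply: cvg_trans (pos _ vn0); apply: near_eq_cvg; near=> t.
  have t0 : 0 < t by near: t; exact: nbhs_right_gt.
  rewrite !mulrN amenable_derive1_odd ?mulNr ?opprK//.
  by apply: mulf_neq0; [exact: lt0r_neq0|exact: ltr0_neq0].
- by rewrite gtr0_norm//; exact: pos.
Unshelve. all: by end_near. Qed.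

Lemma qfun_derive1 t : t != 0 ->
  derive1 (qfun rho lam) t = lam * Num.sg t - derive1 rho t.
Proof.
have [_ [_ _ _ dr _]] := rhoA => t0.
have := is_cvg_diff_quotient _ rho t 1 (dr t t0); rewrite mul1r => H.
have {}H : lam * Num.sg t - h^-1 * (rho (t + h * 1) - rho t) @[h --> 0^'] -->
    lam * Num.sg t - derive1 rho t by apply: cvgB => //; exact: cvg_cst.
apply: cvg_lim => //; apply: cvg_trans H; apply: near_eq_cvg; near=> h.
have h0 : h != 0 by near: h; exact: nbhs_dnbhs_neq.
have ht : `|h| < `|t| by near: h; apply: dnbhs0_lt; rewrite normr_gt0.
have E : `|h + t| = `|t| + Num.sg t * h.
  move: ht; rewrite ltr_norml.
  have /orP[tn|tp] : (t < 0) || (0 < t) by rewrite -neq_lt.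
    by rewrite ltr0_sg// (ltr0_norm tn) => /andP[? ?]; rewrite ltr0_norm; lra.
  by rewrite gtr0_sg// (gtr0_norm tp) => /andP[? ?]; rewrite gtr0_norm; lra.
by rewrite /qfun/= /GRing.scale/= E mulr1 [t + h]addrC; field.
Unshelve. all: by end_near. Qed.

(** The kinks of [lam * `|t|] and of [rho] at 0 cancel. *)
Lemma qfun_derive1_0 : continuous rho -> derive1 (qfun rho lam) 0 = 0.
Proof.
have [_ [[even rho0] _ _ _ _]] := rhoA => /amenable_quotient_cvg q.
apply: cvg_lim => //; apply/cvgrPdist_le => e e0.
move/cvgrPdist_le : q => /(_ e e0)[d /= d0 H].
near=> h; have h0 : h != 0 by near: h; exact: nbhs_dnbhs_neq.
have hd : `|h| < d by near: h; exact: dnbhs0_lt.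
have nh0 : 0 < `|h| by rewrite normr_gt0.
rewrite sub0r normrN /qfun addr0 normr0 mulr0 rho0 !subr0 /GRing.scale/=.
have -> : rho h = rho `|h|.
  by have [hn|hp] := ltP h 0; rewrite ?(ltr0_norm hn) ?(ger0_norm hp).
rewrite normrM normfV -[`|h|]gtr0_norm// -normfV -normrM normr_id.
have -> : `|h|^-1 * (lam * `|h| - rho `|h|) = lam - rho `|h| / `|h|.
  by field; rewrite gt_eqF.
by apply: H => //; rewrite /ball_/= sub0r normrN normr_id.
Unshelve. all: by end_near. Qed.

End AmenablePenalty.

(** * Inner products, norms and subgradients *)

Section Dot.
Context {R : realType} {p : nat}.
Implicit Types (u v b z : 'cV[R]_p) (S : {set 'I_p}).

Lemma dotpC u v : dotp u v = dotp v u.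
Proof. by apply: eq_bigr => j _; rewrite mulrC. Qed.

Lemma dotpBl u v b : dotp (u - v) b = dotp u b - dotp v b.
Proof. by rewrite -sumrB; apply: eq_bigr => j _; rewrite !mxE mulrBl. Qed.

Lemma dotpZl a u b : dotp (a *: u) b = a * dotp u b.
Proof. by rewrite mulr_sumr; apply: eq_bigr => j _; rewrite mxE mulrA. Qed.

Lemma dotpZr a u b : dotp u (a *: b) = a * dotp u b.
Proof. by rewrite dotpC dotpZl dotpC. Qed.

Lemma dotp_delta u j : dotp u (delta_mx j 0) = u j 0.
Proof.
rewrite /dotp (bigD1 j)//= !mxE !eqxx mulr1 big1 ?addr0// => i ij.
by rewrite !mxE (negbTE ij) mulr0.
Qed.

Lemma l2norm_sq v : l2norm v ^+ 2 = dotp v v.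
Proof.
by rewrite sqr_sqrtr ?sumr_ge0// => j _; exact: sqr_ge0.
Qed.

Lemma l2normZ a v : l2norm (a *: v) = `|a| * l2norm v.
Proof.
rewrite /l2norm -sqrtr_sqr -sqrtrM ?sqr_ge0// mulr_sumr; congr Num.sqrt.
by apply: eq_bigr => j _; rewrite mxE exprMn.
Qed.

Lemma dotp_gt0 v : v != 0 -> 0 < dotp v v.
Proof.
move=> v0; rewrite lt_neqAle -l2norm_sq sqr_ge0 andbT eq_sym l2norm_sq.
apply: contra v0; rewrite psumr_eq0 => [/allP v0|j _];
  last by rewrite -expr2 sqr_ge0.
apply/eqP/colP => j; rewrite mxE; apply/eqP.
by have := v0 j (mem_index_enum _); rewrite -expr2 sqrf_eq0.
Qed.

Lemma suppP S v :
  reflect (forall j, j \notin S -> v j 0 = 0) (supp v \subset S).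
Proof.
apply: (iffP fintype.subsetP) => [sv j jS|sv j].
  by apply/eqP; apply: contraNT jS => vj; apply: sv; rewrite inE.
by rewrite inE; apply: contraNT => /sv ->.
Qed.

(** Cauchy-Schwarz against the indicator of [S], here from
    [a i * a j <= a i ^+ 2 / 2 + a j ^+ 2 / 2] summed over all pairs in [S]. *)
Lemma l1norm_sq_le S v : supp v \subset S ->
  l1norm v ^+ 2 <= #|S|%:R * l2norm v ^+ 2.
Proof.
move=> /suppP sv; rewrite l2norm_sq.
have E (F : 'I_p -> R) : (forall j, j \notin S -> F j = 0) ->
    \sum_j F j = \sum_(j in S) F j.
  move=> F0; rewrite [LHS](bigID (mem S))/= [X in _ + X]big1 ?addr0//.
rewrite /l1norm /dotp !E => [| j /sv -> | j /sv ->]; rewrite ?mul0r ?normr0//.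
set a := fun j => `|v j 0|.
have -> : (\sum_(j in S) `|v j 0|) ^+ 2 = \sum_(i in S) \sum_(j in S) a i * a j.
  by rewrite expr2 mulr_suml; apply: eq_bigr => i _; rewrite mulr_sumr.
have -> : \sum_(j in S) v j 0 * v j 0 =
    \sum_(j in S) a j ^+ 2 / 2 + \sum_(j in S) a j ^+ 2 / 2.
  rewrite -big_split; apply: eq_bigr => j _ /=.
  by rewrite /a real_normK ?num_real// -splitr expr2.
have -> : #|S|%:R * (\sum_(j in S) a j ^+ 2 / 2 + \sum_(j in S) a j ^+ 2 / 2) =
    \sum_(i in S) \sum_(j in S) (a i ^+ 2 / 2 + a j ^+ 2 / 2).
  under [RHS]eq_bigr do rewrite big_split/= sumr_const.
  by rewrite big_split/= sumr_const mulr_natl mulrnDl -sumrMnl.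
apply: ler_sum => i _; apply: ler_sum => j _.
have := sqr_ge0 (a i - a j); lra.
Qed.

(** Only the coordinate [j] of the point is moved: to its sum with the sign of
    [z j], which bounds [z j], and to 0, which gives the equality case. *)
Lemma subgradient_l1normP x z : subgradient (@l1norm R p) x z ->
  forall j, `|z j 0| <= 1 /\ z j 0 * x j 0 = `|x j 0|.
Proof.
move=> sg j.
have H s : `|x j 0| + z j 0 * s <= `|x j 0 + s|.
  have := sg (x + s *: delta_mx j 0); rewrite addrAC subrr add0r dotpZr
    dotp_delta.
  rewrite /l1norm (bigD1 j)//= [X in _ <= X](bigD1 j)//= !mxE !eqxx mulr1.
  have -> : \sum_(i < p | i != j) `|(x + s *: delta_mx j 0) i 0| =
            \sum_(i < p | i != j) `|x i 0|.
    by apply: eq_bigr => i ij; rewrite !mxE (negbTE ij) mulr0 addr0.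
  by rewrite addrAC lerD2r [s * _]mulrC.
have z1 : `|z j 0| <= 1.
  have := H (Num.sg (z j 0)); rewrite mulrC -normrEsg => /le_trans.
  move=> /(_ _ (ler_normD _ _)); rewrite lerD2l => /le_trans; apply.
  by rewrite normr_sg; case: (_ != _).
split=> //; apply/eqP; rewrite eq_le; apply/andP; split; last first.
  by have := H (- x j 0); rewrite subrr normr0 mulrN subr_le0.
apply: le_trans (ler_norm _) _; rewrite normrM; exact: ler_piMl.
Qed.

End Dot.

(** * Gradient and Hessian along segments *)

Section Calc.
Context {R : realType} {p : nat}.
Implicit Types (f : 'cV[R]_p -> R) (u v x : 'cV[R]_p) (S : {set 'I_p}).

Lemma col_sum_delta v : v = \sum_j v j 0 *: delta_mx j 0.
Proof.
apply/colP => i; rewrite summxE (bigD1 i)//= !mxE !eqxx mulr1 big1 ?addr0//.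
by move=> j ji; rewrite !mxE eq_sym (negbTE ji) mulr0.
Qed.

Lemma derive_grad f x v : differentiable f x -> 'D_v f x = dotp (grad f x) v.
Proof.
move=> df; rewrite deriveE// {1}[v]col_sum_delta linear_sum.
by apply: eq_bigr => j _; rewrite linearZ -deriveE// mxE mulrC.
Qed.

Lemma derive_hessian f x v :
  differentiable (grad f) x -> 'D_v (grad f) x = hessian f x *m v.
Proof.
move=> df; rewrite deriveE// {1}[v]col_sum_delta linear_sum.
apply/colP => i; rewrite summxE [RHS]mxE; apply: eq_bigr => j _.
rewrite linearZ -deriveE// derive_mx; last exact: diff_derivable.
by rewrite !mxE mulrC.
Qed.

Lemma is_derive_along (W : normedModType R) (F : 'cV[R]_p -> W) x v (t : R) :
  differentiable F (x + t *: v) ->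
  is_derive t (1 : R) (fun s : R => F (x + s *: v)) ('D_v F (x + t *: v)).
Proof.
move=> dF; have E : (fun h : R => h^-1 *:
    (((fun s : R => F (x + s *: v)) \o shift t) (h *: 1) - F (x + t *: v))) =
  (fun h => h^-1 *: ((F \o shift (x + t *: v)) (h *: v) - F (x + t *: v))).
  apply/funext => h /=; congr (_ *: (F _ - _)).
  by rewrite scaler1 scalerDl addrCA.
split; last by rewrite /derive E.
by rewrite /derivable E; exact: diff_derivable.
Qed.

Lemma is_derive_dotp_grad f x v u (t : R) :
  differentiable (grad f) (x + t *: v) ->
  is_derive t (1 : R) (fun s : R => dotp (grad f (x + s *: v)) u)
    (dotp (hessian f (x + t *: v) *m v) u).
Proof.
move=> dg; have [dG eG] := is_derive_along _ _ _ _ _ dg.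
have dj j : is_derive t (1 : R) (fun s : R => grad f (x + s *: v) j 0)
    ((hessian f (x + t *: v) *m v) j 0).
  split; first by have /derivable_mxP := dG; exact.
  by move: eG; rewrite derive_mx// derive_hessian// => /colP/(_ j); rewrite mxE.
have -> : (fun s : R => dotp (grad f (x + s *: v)) u) =
    \sum_(j < p) (u j 0 *: (fun s : R => grad f (x + s *: v) j 0)).
  apply/funext => s; rewrite fct_sumE; apply: eq_bigr => j _.
  by rewrite mulrC.
apply: is_derive_eq; apply: eq_bigr => j _.
by rewrite mulrC.
Qed.

Lemma continuous_hessian_along f x v i j : continuous (hessian f) ->
  continuous (fun t : R => hessian f (x + t *: v) i j).
Proof.
move=> ch t; apply: (@continuous_comp _ _ _
  (fun s : R => hessian f (x + s *: v)) (fun M : 'M[R]_p => M i j));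
  last exact: coord_continuous.
apply: (@continuous_comp _ _ _ (fun s : R => x + s *: v) (hessian f));
  last exact: ch.
apply: continuousD; first exact: cst_continuous.
exact: scalel_continuous.
Qed.

Lemma dotp_mulmx (M : 'M[R]_p) v u :
  dotp (M *m v) u = \sum_ij M ij.1 ij.2 * (v ij.2 0 * u ij.1 0).
Proof.
rewrite -(pair_bigA _ (fun i j => M i j * (v j 0 * u i 0)))/=.
by apply: eq_bigr => i _; rewrite mxE mulr_suml; apply: eq_bigr => j _;
  rewrite mulrA.
Qed.

Lemma continuous_hessian_dotp f x v w u : continuous (hessian f) ->
  continuous (fun t : R => dotp (hessian f (x + t *: v) *m w) u).
Proof.
move=> ch t; under eq_fun do rewrite dotp_mulmx.
apply: cvg_big => [|ij _]; first exact: add_continuous.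
by apply: cvgM; [exact: continuous_hessian_along|exact: cvg_cst].
Qed.

(** The average Hessian is integrated entry by entry; its bilinear form is then
    an integral of bilinear forms, as these are finite sums of entries. *)
Lemma avg_hessian_dotp f x y v u : continuous (hessian f) ->
  dotp (avg_hessian f x y *m v) u =
  Rintegral lebesgue_measure `[0, 1]
    (fun t => dotp (hessian f (x + t *: (y - x)) *m v) u).
Proof.
move=> ch.
have ih (i j : 'I_p) : lebesgue_measure.-integrable `[0, 1]
    (EFin \o (fun t : R => hessian f (x + t *: (y - x)) i j)).
  apply: continuous_compact_integrable; first exact: segment_compact.
  by apply: continuous_subspaceT; exact: continuous_hessian_along.
under [in RHS]eq_Rintegral do rewrite dotp_mulmx.
rewrite dotp_mulmx /Rintegral; under [in RHS]eq_integral do rewrite -sumEFin.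
have ih' (ij : 'I_p * 'I_p) : lebesgue_measure.-integrable `[0%R, 1%R]
    (fun t : R => (hessian f (x + t *: (y - x)) ij.1 ij.2 *
                   (v ij.2 0 * u ij.1 0))%:E).
  exact: (integrableZr _ (v ij.2 0 * u ij.1 0) (ih ij.1 ij.2)).
rewrite integral_sum// -sum_fine => [|ij _]; last exact: integrable_fin_num.
apply: eq_bigr => ij _; rewrite -[RHS]/(Rintegral _ _ _) RintegralZr//.
by rewrite mxE.
Qed.

Lemma avg_hessian_lower_bound f x y v c : continuous (hessian f) ->
  (forall z, c <= dotp (hessian f z *m v) v) ->
  c <= dotp (avg_hessian f x y *m v) v.
Proof.
move=> ch cH; rewrite avg_hessian_dotp//.
have -> : c = Rintegral lebesgue_measure `[0, 1] (fun=> c).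
  by rewrite Rintegral_cst//= lebesgue_measure_itv/= lte_fin ltr01 oppr0 adde0
    mulr1.
apply: le_Rintegral => //; apply: continuous_compact_integrable;
  try exact: segment_compact; apply: continuous_subspaceT.
  by move=> t; exact: cvg_cst.
exact: continuous_hessian_dotp.
Qed.

(** The fundamental theorem of calculus, applied to each coordinate of the
    gradient along the segment from [x] to [y]. *)
Lemma grad_sub_avg_hessian f x y : (forall z, differentiable (grad f) z) ->
  continuous (hessian f) ->
  grad f y - grad f x = avg_hessian f x y *m (y - x).
Proof.
move=> dg ch; apply/colP => i; rewrite -!dotp_delta avg_hessian_dotp//.
set u := delta_mx i 0; pose phi (t : R) := dotp (grad f (x + t *: (y - x))) u.
have dphi t := is_derive_dotp_grad f x (y - x) u t (dg _).
have cphi : continuous phi.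
  by move=> t; apply/differentiable_continuous/derivable1_diffP; case: (dphi t).
rewrite /Rintegral (@continuous_FTC2 R _ phi)//.
- by rewrite /phi scale1r scale0r addr0 [x + _]addrC subrK dotpBl.
- apply: continuous_subspaceT => t.
  exact: continuous_hessian_dotp.
- split; [by move=> t _; case: (dphi t)| |].
    exact/cvg_at_right_filter/cphi.
  exact/cvg_at_left_filter/cphi.
- by move=> t _; rewrite derive1E; case: (dphi t).
Qed.

(** Test the hypothesis at [h *: v]: both sides are quadratic in [h] to leading
    order, and dividing by [h ^+ 2] lets the difference quotient of the gradient
    tend to the Hessian.  A strong convexity that holds only for short
    increments is therefore enough. *)
Lemma hessian_lower_bound f x v c S : differentiable (grad f) x ->
  (forall D, supp D \subset S -> l2norm D <= 1 ->
    c * dotp D D <= dotp (grad f (x + D) - grad f x) D) ->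
  supp v \subset S -> c * dotp v v <= dotp (hessian f x *m v) v.
Proof.
move=> dg sc /suppP sv.
have dphi := is_derive_dotp_grad f x v v 0; rewrite scale0r addr0 in dphi.
have [dd ed] := dphi dg.
have q := is_cvg_diff_quotient _ _ _ 1 dd.
rewrite mul1r derive1E ed in q; move/cvg_dnbhs_at_right : q => q.
rewrite -(cvg_lim _ q)//; apply: limr_ge;
  first by apply/cvg_ex; eexists; exact: q.
have l2 : 0 <= l2norm v by exact: sqrtr_ge0.
near=> h; have h0 : 0 < h by near: h; exact: nbhs_right_gt.
have hv : h * l2norm v <= 1.
  have : h < (1 + l2norm v)^-1 by near: h; apply: nbhs_right_lt;
    rewrite invr_gt0; lra.
  rewrite -[X in _ < X]mul1r ltr_pdivlMr; lra.
rewrite ler_pdivlMl// mulr1 add0r scale0r addr0 -dotpBl.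
have := sc (h *: v); rewrite l2normZ gtr0_norm// => /(_ _ hv).
rewrite !dotpZr dotpZl mulrCA.
rewrite ler_pM2l// mulrCA; apply.
by apply/suppP => j jS; rewrite mxE sv// mulr0.
Unshelve. all: by end_near. Qed.

End Calc.

(** * Entrywise norms, restriction to a support and strict minimizers *)

Section Norms.
Context {R : realType}.

Lemma mx_norm_le m n (A : 'M[R]_(m, n)) c :
  0 <= c -> (forall i j, `|A i j| <= c) -> `|A| <= c.
Proof.
move=> c0 Ac; rewrite [leLHS]/Num.Def.normr/= mx_normrE.
by apply: bigmax_le => // -[i j] _ /=.
Qed.

Lemma entry_le_mx_norm m n (A : 'M[R]_(m, n)) i j : `|A i j| <= `|A|.
Proof.
by rewrite [leRHS]/Num.Def.normr/= mx_normrE; exact: (le_bigmax _ _ (i, j)).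
Qed.

Lemma mulmx_le_opnorm_inf m (M : 'M[R]_m) (w : 'cV[R]_m) c :
  0 <= c -> (forall i, `|w i 0| <= c) -> `|M *m w| <= c * opnorm_inf M.
Proof.
move=> c0 wc; apply: mx_norm_le => [|i j].
  by rewrite mulr_ge0// /opnorm_inf bigmax_ge_id.
rewrite mxE; apply: le_trans (ler_norm_sum _ _ _) _.
apply: (@le_trans _ _ (c * \sum_j `|M i j|)).
  rewrite mulr_sumr; apply: ler_sum => k _.
  by rewrite normrM mulrC ler_wpM2r// (ord1 j).
by rewrite ler_wpM2l// /opnorm_inf; exact: le_bigmax.
Qed.

Lemma unitmx_of_ker0 m (M : 'M[R]_m) :
  (forall v : 'cV[R]_m, M *m v = 0 -> v = 0) -> M \in unitmx.
Proof.
move=> kM; rewrite -unitmx_tr -row_free_unit -kermx_eq0; apply/rowV0P => v.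
move/sub_kermxP => vM; apply: trmx_inj; rewrite trmx0; apply: kM.
by apply: trmx_inj; rewrite trmx_mul trmxK trmx0.
Qed.

End Norms.

Lemma mean_value (R : realType) (phi dphi : R -> R) (a b : R) : a < b ->
  (forall t, is_derive t (1 : R) phi (dphi t)) ->
  exists2 c, a < c < b & phi b - phi a = dphi c * (b - a).
Proof.
move=> ab dphiE; have [|c] := @MVT R phi dphi a b ab (fun t _ => dphiE t).
  apply: continuous_subspaceT => t.
  by apply/differentiable_continuous/derivable1_diffP; case: (dphiE t).
by rewrite in_itv => cab ->; exists c.
Qed.

Section Restrict.
Context {R : realType} {p : nat}.
Implicit Types (f : 'cV[R]_p -> R) (u v x y b z : 'cV[R]_p) (S : {set 'I_p}).

Lemma subvec_entry S v j (jS : j \in S) :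
  v j 0 = subvec S v (enum_rank_in jS j) 0.
Proof. by rewrite mxE enum_rankK_in. Qed.

Lemma norm_subvec S v : supp v \subset S -> `|v| <= `|subvec S v|.
Proof.
move=> /suppP sv; apply: mx_norm_le => // j i; rewrite (ord1 i).
have [jS|/sv ->] := boolP (j \in S); last by rewrite normr0.
by rewrite (subvec_entry S v j jS) entry_le_mx_norm.
Qed.

(** The columns of [M] outside [S] meet only vanishing coordinates of [v], which
    lets an equation in [R^p] be read in the coordinates of [S]. *)
Lemma principal_submx_mul S (M : 'M[R]_p) v : supp v \subset S ->
  principal_submx S M *m subvec S v = subvec S (M *m v).
Proof.
move=> /suppP sv; apply/colP => i; rewrite !mxE.
rewrite [RHS](bigID (mem S))/= [X in _ = _ + X]big1 ?addr0 => [|j /sv ->];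
  last by rewrite mulr0.
rewrite [RHS]big_enum_val/=; apply: eq_bigr => k _.
by rewrite !mxE.
Qed.

Lemma subvec_surj S (w : 'cV[R]_#|S|) :
  exists2 v, supp v \subset S & subvec S v = w.
Proof.
exists (\col_j \sum_(k | enum_val k == j) w k 0).
  apply/suppP => j jS; rewrite mxE big1// => k /eqP kj.
  by rewrite -kj enum_valP in jS.
apply/colP => i; rewrite !mxE (eq_bigl (pred1 i)) ?big_pred1_eq// => k.
exact: (inj_eq enum_val_inj).
Qed.

Lemma dotp_eq0_of_subvec S u v :
  supp v \subset S -> subvec S u = 0 -> dotp u v = 0.
Proof.
move=> /suppP sv u0; rewrite /dotp big1// => j _.
have [jS|/sv ->] := boolP (j \in S); last by rewrite mulr0.
by rewrite (subvec_entry S u j jS) u0 mxE mul0r.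
Qed.

(** A kernel vector of the submatrix, extended by 0 outside [S], is annihilated
    by the quadratic form of [M]. *)
Lemma principal_submx_unit S (M : 'M[R]_p) :
  (forall v, supp v \subset S -> v != 0 -> 0 < dotp (M *m v) v) ->
  principal_submx S M \in unitmx.
Proof.
move=> pd; apply: unitmx_of_ker0 => w Mw.
have [v sv vw] := subvec_surj S w; rewrite -vw in Mw *.
have [->|v0] := eqVneq v 0; first by apply/colP => i; rewrite !mxE.
have := pd v sv v0; rewrite principal_submx_mul// in Mw.
by rewrite (dotp_eq0_of_subvec S)// ltxx.
Qed.

(** Along the segment from [b] to [y] the slope of [f] starts at 0 and has a
    positive derivative; the mean value theorem, once for [f] and once for the
    slope, gives [f b < f y]. *)
Lemma restricted_strict_minimizer f S b :
  twice_cont_diff f -> supp b \subset S -> subvec S (grad f b) = 0 ->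
  (forall x v, supp v \subset S -> v != 0 -> 0 < dotp (hessian f x *m v) v) ->
  oracle f S = [set b].
Proof.
move=> [df dg _] sb g0 pd.
have lt_min y : supp y \subset S -> y != b -> f b < f y.
  move=> sy yb; pose v := y - b.
  have bv : b + v = y by rewrite addrC subrK.
  have v0 : v != 0 by rewrite subr_eq0.
  have sv : supp v \subset S.
    by apply/suppP => j jS; rewrite !mxE (suppP _ _ sy)// (suppP _ _ sb)//
      subrr.
  have df1 (t : R) : is_derive t (1 : R) (fun t : R => f (b + t *: v))
      (dotp (grad f (b + t *: v)) v).
    by rewrite -derive_grad//; exact: is_derive_along.
  have dg1 t := is_derive_dotp_grad f b v v t (dg _).
  have [s /andP[s0 s1]] := mean_value _ (fun t : R => f (b + t *: v))
    (fun t => dotp (grad f (b + t *: v)) v) 0 1 ltr01 df1.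
  rewrite scale1r scale0r addr0 bv subr0 mulr1.
  have [r _] := mean_value _ (fun t : R => dotp (grad f (b + t *: v)) v)
    (fun t => dotp (hessian f (b + t *: v) *m v) v) 0 s s0 dg1.
  rewrite scale0r addr0 subr0 (dotp_eq0_of_subvec S (grad f b))// subr0.
  move=> E1 E2.
  by rewrite -subr_gt0 E2 E1 mulr_gt0// pd.
apply/seteqP; split => [y [sy ymin]|_ ->].
  apply/eqP; apply: contraT => /(lt_min _ sy) /lt_le_trans /(_ (ymin _ sb)).
  by rewrite ltxx.
by split=> // y sy; have [->//|/(lt_min _ sy)/ltW] := eqVneq y b.
Qed.

End Restrict.

(** * Stationarity from a zero subgradient *)

Section Stationarity.
Context {R : realType} {p : nat} (rho : R -> R) (lam mu : R).
Hypotheses (rhoA : amenable rho lam mu) (crho : continuous rho).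
Implicit Types (f : 'cV[R]_p -> R) (b z : 'cV[R]_p).

(** Where [b] does not vanish, [z] is the sign of [b] and cancels the [lam] part
    of the derivative of [qfun]; where [b] vanishes, that derivative is 0. *)
Lemma zero_subgradient_coord f b z :
  grad f b - sep_grad (qfun rho lam) b + lam *: z = 0 ->
  (forall j, z j 0 * b j 0 = `|b j 0|) ->
  forall j, grad f b j 0 =
    if b j 0 == 0 then - (lam * z j 0) else - derive1 rho (b j 0).
Proof.
move=> /colP E zb j; move/(_ j): E; rewrite !mxE.
have [->|b0] := eqVneq (b j 0) 0.
  by rewrite (qfun_derive1_0 _ _ _ rhoA crho); lra.
have -> : z j 0 = Num.sg (b j 0) by apply: (mulIf b0); rewrite zb normrEsg.
by rewrite (qfun_derive1 _ _ _ rhoA)//; lra.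
Qed.

(** Coordinatewise, the slopes of the loss and of the penalty cancel where [b]
    does not vanish, and elsewhere [lam * `|v j 0|] dominates
    [lam * z j 0 * v j 0]. *)
Lemma zero_subgradient_stationary f Om rad b z :
  0 <= lam -> feasible Om rad b ->
  grad f b - sep_grad (qfun rho lam) b + lam *: z = 0 ->
  (forall j, `|z j 0| <= 1) -> (forall j, z j 0 * b j 0 = `|b j 0|) ->
  stationary_point f rho Om rad b.
Proof.
move=> lam0 fb E z1 zb; split=> // b' _; move: (b' - b) => v.
exists (\sum_j (if b j 0 == 0 then lam * `|v j 0|
                 else derive1 rho (b j 0) * v j 0)).
  apply: cvg_big => [|j _]; first exact: add_continuous.
  by under eq_cvg do rewrite !mxE; exact: amenable_right_limit rhoA _ _.
rewrite /dotp -big_split sumr_ge0// => j _ /=.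
rewrite (zero_subgradient_coord _ _ _ E zb); case: ifP => _;
  last by rewrite mulNr addNr.
rewrite mulNr addrC subr_ge0 -mulrA ler_wpM2l//.
by apply: le_trans (ler_norm _) _; rewrite normrM ler_piMl.
Qed.

End Stationarity.

(** * Curvature from restricted strong convexity *)

Section RSCCurvature.
Context {R : realType} {p : nat}.
Implicit Types (f : 'cV[R]_p -> R) (v x : 'cV[R]_p) (S : {set 'I_p}).

(** [kappa] bounds what the l_1 term of the condition costs on vectors supported
    in [S].  The Hessian only sees short increments, hence only the quadratic
    regime of the condition. *)
Lemma RSC_hessian_lower_bound f n S (alpha1 tau1 alpha2 tau2 kappa : R) x v :
  RSC n f alpha1 tau1 alpha2 tau2 -> differentiable (grad f) x ->
  tau1 * (ln p%:R / n%:R) * #|S|%:R <= kappa ->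
  supp v \subset S -> (alpha1 - kappa) * dotp v v <= dotp (hessian f x *m v) v.
Proof.
move=> [_ _ tau10 _ rsc] dg le_kappa; apply: hessian_lower_bound => // D sD D1.
apply: le_trans (proj1 (rsc x D) D1); rewrite -l2norm_sq mulrBl lerB//.
have t0 : 0 <= tau1 * (ln p%:R / n%:R).
  have [->|p0] := posnP p; first by rewrite ln0// mul0r mulr0.
  by rewrite mulr_ge0// divr_ge0// ln_ge0// ler1n.
apply: le_trans (ler_wpM2l t0 (l1norm_sq_le S D sD)) _.
by rewrite [leLHS]mulrA ler_wpM2r// sqr_ge0.
Qed.

End RSCCurvature.

(** To be used with [L = tau1 * ln p].  The last two hypotheses give
    [4 * rad * L <= n * lam], and the radius is at least
    [60 * k * lam / (2 * alpha1 - mu)]: together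
    [240 * k * L <= (2 * alpha1 - mu) * n]. *)
Lemma sample_size_bound (R : realFieldType)
    (alpha1 mu lam rad k L n delta : R) :
  0 <= mu -> mu < alpha1 -> 0 < lam -> 0 < rad -> 0 <= L -> 0 < n ->
  60 * k * lam / (2 * alpha1 - mu) <= rad ->
  4 * rad * L / (n * lam) <= delta -> delta <= 1 ->
  L / n * k <= alpha1 / 120.
Proof.
move=> mu0 mu1 lam0 rad0 L0 n0.
have A0 : 0 < 2 * alpha1 - mu by lra.
rewrite ler_pdivrMr// => kr dl d1.
have : 4 * rad * L <= n * lam.
  by have := le_trans dl d1; rewrite ler_pdivrMr ?mulr_gt0// mul1r.
move=> H; rewrite mulrAC ler_pdivrMr//.
have H1 : 60 * k * lam * L <= rad * (2 * alpha1 - mu) * L by rewrite ler_wpM2r.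
have H2 : (2 * alpha1 - mu) * (4 * rad * L) <= (2 * alpha1) * (n * lam).
  apply: ler_pM => //; [exact: ltW| |lra].
  by rewrite !mulr_ge0// ltW.
rewrite -(ler_pM2r lam0).
lra.
Qed.

Theorem theorem2 (R : realType) (p n k : nat)
  (hp : (0 < p)%N) (hn : (0 < n)%N) (hk : (0 < k)%N)
  (Om : set 'cV[R]_p) (Om_open : open Om) (Om_convex : convex_set Om)
  (* random losses for every sample size, and the population minimizer *)
  (d : measure_display) (T : measurableType d) (P : probability T R)
  (loss : nat -> 'cV[R]_p -> {RV P >-> R}) (bstar : 'cV[R]_p)
  (bstar_target : forall m : nat, (0 < m)%N ->
     argmin Om (fun b => 'E_P[loss m b])%E = [set bstar])
  (bstar_sparse : (#|supp bstar| <= k)%N)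
  (* the realized loss for the given n samples *)
  (w : T) (Ln : 'cV[R]_p -> R) (Ln_def : Ln = (fun b => loss n b w))
  (Ln_C2 : twice_cont_diff Ln)
  (alpha1 tau1 alpha2 tau2 : R) (Ln_RSC : RSC n Ln alpha1 tau1 alpha2 tau2)
  (lam rad mu : R) (lam_gt0 : 0 < lam) (rad_gt0 : 0 < rad)
  (rho : R -> R) (rho_cont : continuous rho)
  (rho_amenable : amenable rho lam mu) (mu_lt : mu < alpha1)
  (lam_lb : 2 * Num.max `|grad Ln bstar|
                        (alpha2 * Num.sqrt (ln k%:R / n%:R)) <= lam)
  (lam_ub : lam <= Num.sqrt ((2 * alpha1 - mu) * alpha2 / (56 * k%:R)))
  (rad_lb : Num.max (2 * l1norm bstar) (60 * k%:R * lam / (2 * alpha1 - mu))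
              <= rad)
  (* extended reals: a / 0 = +oo for a > 0, covering tau2 = 0 and p = 1 *)
  (rad_ub : (rad%:E <= Order.min (alpha2 / (8 * lam))%:E
              (alpha2%:E / tau2%:E * sqrte (n%:R%:E / (ln p%:R)%:E)))%E)
  (n_lb : 2 * tau1 / (2 * alpha1 - mu) * k%:R * ln p%:R <= n%:R)
  (bhat zhat : 'cV[R]_p)
  (bhat_pdw : pdw Ln rho Om rad lam (supp bstar) bhat zhat)
  (delta : R)
  (delta_lb : 4 * rad * tau1 * ln p%:R / (n%:R * lam) <= delta)
  (delta_ub : delta <= 1)
  (strict_dual : `|subvec (~: supp bstar)%SET zhat| <= 1 - delta) :
  let S := supp bstar in
  let QSS := principal_submx S (avg_hessian Ln bstar bhat) in
  let gS := subvec S (grad Ln bstar) in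
  [/\ stationary_point Ln rho Om rad bhat,
      QSS \in unitmx,
      `|bhat - bstar| <= `|invmx QSS *m gS| + lam * opnorm_inf (invmx QSS) &
      forall gamma : R, amenable_flat rho lam mu gamma ->
        ((lam * (gamma + opnorm_inf (invmx QSS)) + `|invmx QSS *m gS|)%:E
           <= min_abs S bstar)%E ->
        oracle Ln S = [set bhat] /\
        `|bhat - bstar| <= `|invmx QSS *m gS|].
Proof.
have [mu0 _] := rho_amenable; have [df dg ch] := Ln_C2.
have [a10 _ tau10 _ _] := Ln_RSC.
have n0 : 0 < n%:R :> R by rewrite ltr0n.
have lnp0 : 0 <= ln p%:R :> R by rewrite ln_ge0// ler1n.
have [[[suppb feasb] _] subg zsg] := bhat_pdw.
move=> S QSS gS; rewrite -/S in suppb subg strict_dual.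
pose c : R := alpha1 - alpha1 / 120; have c0 : 0 < c by rewrite /c; lra.
(* alpha1 / 120 bounds the cost of the l_1 term; only 0 < c matters below *)
have curv x v : supp v \subset S -> c * dotp v v <= dotp (hessian Ln x *m v) v.
  move=> sv; apply: (RSC_hessian_lower_bound _ _ _ _ _ _ _ _ _ _
    Ln_RSC (dg x) _ sv).
  move: rad_lb; rewrite ge_max => /andP[_ rlb].
  have := @sample_size_bound R alpha1 mu lam rad k%:R (tau1 * ln p%:R) n%:R
    delta.
  rewrite [4 * rad * _]mulrA.
  move=> /(_ mu0 mu_lt lam_gt0 rad_gt0 (mulr_ge0 tau10 lnp0) n0 rlb delta_lb
    delta_ub).
  by apply: le_trans; rewrite mulrA ler_wpM2l ?ler_nat// divr_ge0 ?mulr_ge0.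
have QSSu : QSS \in unitmx.
  apply: principal_submx_unit => v sv v0.
  apply: lt_le_trans
    (avg_hessian_lower_bound _ _ _ _ _ ch (fun z => curv z v sv)).
  by rewrite mulr_gt0// dotp_gt0.
have zb j : `|zhat j 0| <= 1 /\ zhat j 0 * bhat j 0 = `|bhat j 0|.
  have [jS|jS] := boolP (j \in S).
    have := subgradient_l1normP _ _ subg (enum_rank_in jS j).
    by rewrite -!subvec_entry.
  rewrite (suppP _ _ suppb _ jS) mulr0 normr0; split=> //.
  have jSC : j \in (~: S)%SET by rewrite inE.
  rewrite (subvec_entry (~: S)%SET _ _ jSC).
  apply: le_trans (entry_le_mx_norm _ _ _ _ _) (le_trans strict_dual _).
  rewrite gerBl; apply: le_trans delta_lb.
  by rewrite divr_ge0 ?mulr_ge0// ltW.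
have gb := zero_subgradient_coord _ _ _ rho_amenable rho_cont _ _ _ zsg
  (fun j => (zb j).2).
have sD : supp (bhat - bstar) \subset S.
  apply/suppP => j jS; rewrite !mxE (suppP _ _ suppb _ jS).
  by rewrite (suppP _ _ (fintype.subxx S) _ jS) subrr.
have ID : subvec S (bhat - bstar) = invmx QSS *m (subvec S (grad Ln bhat) - gS).
  have : QSS *m subvec S (bhat - bstar) = subvec S (grad Ln bhat) - gS.
    rewrite principal_submx_mul// -grad_sub_avg_hessian//.
    by apply/colP => i; rewrite !mxE.
  by move=> <-; rewrite mulKmx.
have bound :
    `|bhat - bstar| <= `|invmx QSS *m gS| + lam * opnorm_inf (invmx QSS).
  apply: le_trans (norm_subvec _ _ sD) _; rewrite ID mulmxBr [leRHS]addrC.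
  apply: le_trans (ler_normB _ _) _; rewrite lerD2r.
  apply: mulmx_le_opnorm_inf => [|i]; first exact: ltW.
  rewrite mxE gb; case: eqP => [_|/eqP b0].
    by rewrite normrN normrM gtr0_norm// ler_piMr ?(ltW lam_gt0)//;
      case: (zb (enum_val i)).
  by rewrite normrN; exact: amenable_norm_derive1 rho_amenable _ _ _.
split=> //.
  apply: (zero_subgradient_stationary _ _ _ rho_amenable rho_cont _ _ _ _ _ _
    _ zsg) => //.
  - exact: ltW.
  - by move=> j; case: (zb j).
  - by move=> j; case: (zb j).
move=> gamma [_ gamma0 flat] bmin.
have g0 : subvec S (grad Ln bhat) = 0.
  apply/colP => i; rewrite [RHS]mxE mxE; set j := enum_val i.
  have jS : j \in S by exact: enum_valP.
  (* bstar is large on S and bhat is close, so bhat reaches the flat part *)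
  have : gamma * lam <= `|bhat j 0|.
    have bj : lam * (gamma + opnorm_inf (invmx QSS)) + `|invmx QSS *m gS| <=
      `|bstar j 0|.
      rewrite -lee_fin; apply: le_trans bmin _.
      exact: (bigmin_le_cond (P := mem S) _ (fun j => (`|bstar j 0|)%:E)).
    have := entry_le_mx_norm _ _ (bhat - bstar) j 0.
    rewrite !mxE => /le_trans /(_ bound).
    have := ler_distD 0 (bstar j 0) (bhat j 0).
    rewrite subr0 sub0r normrN.
    have := ler_normD (bhat j 0) (bstar j 0 - bhat j 0).
    rewrite [bhat j 0 + _]addrC subrK [`|bstar _ _ - _|]distrC.
    lra.
  move=> gl; have bj0 : bhat j 0 != 0.
    by rewrite -normr_gt0; apply: lt_le_trans gl; rewrite mulr_gt0.
  rewrite gb (negbTE bj0).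
  have := flat _ gl; have [b0|b0] := leP 0 (bhat j 0).
    by rewrite ger0_norm// => ->; rewrite oppr0.
  by rewrite ltr0_norm// (amenable_derive1_odd _ _ _ rho_amenable).
split.
  apply: restricted_strict_minimizer => // x v sv v0.
  by apply: lt_le_trans (curv x v sv); rewrite mulr_gt0// dotp_gt0.
apply: le_trans (norm_subvec _ _ sD) _.
by rewrite ID g0 sub0r mulmxN normrN.
Qed.
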